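(* For every integer $n\geq 1$, the set $\Omega_{|s_n|}(\mathbf{s})$ of factors of $\mathbf{s}$ of length $|s_n|$ is the disjoint union $\Omega_n^0\,\dot\cup\,\Omega_n^1\,\dot\cup\cdots\dot\cup\,\Omega_n^{k-1}$, where $\Omega_n^0=\{C_j(s_n):0\leq j\leq |s_n|-1\}$ and, for $1\leq r\leq k-1$, $\Omega_n^r$ is the set of words $w$ with $|w|=|s_n|$ that are factors of $x^{-1}\widetilde{G}_{n,r}D_{n-r}G_{n,r}x^{-1}$, $x$ being the last letter of $G_{n,r}$.
   Context: Fix $k\geq 2$ and the alphabet $\mathcal{A}_k=\{a_1,\dots,a_k\}$. An infinite word $\mathbf{t}$ is standard episturmian with directive word $x_1x_2x_3\cdots$ if its palindromic prefixes $u_1=\varepsilon,u_2,\dots$ satisfy $u_{n+1}=(u_nx_n)^{(+)}$, where $w^{(+)}$ is the shortest palindrome having $w$ as a prefix, and $\mathbf{t}=\lim_n u_n$. Let $(d_i)_{i\geq1}$ be positive integers and let $\mathbf{s}$ be the standard episturmian word with directive word $a_1^{d_1}a_2^{d_2}\cdots a_k^{d_k}a_1^{d_{k+1}}\cdots a_k^{d_{2k}}a_1^{d_{2k+1}}\cdots$. Define $s_{1-k}=a_2,\dots,s_{-1}=a_k,s_0=a_1$; $s_n=s_{n-1}^{d_n}\cdots s_0^{d_1}a_{n+1}$ for $1\leq n\leq k-1$; $s_n=s_{n-1}^{d_n}\cdots s_{n-k+1}^{d_{n-k+2}}s_{n-k}$ for $n\geq k$. Define $D_0=a_1^{d_1-1}$,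 $D_m=s_m^{d_{m+1}-1}s_{m-1}^{d_m}\cdots s_1^{d_2}s_0^{d_1}$ for $m\geq1$, and formally $D_{-j}=a_{k+1-j}^{-1}$ ($|D_{-j}|=-1$) for $1\leq j\leq k$. Products with inverse letters are computed in the free group on $\mathcal{A}_k$ ($u^{-1}w$ means $w$ with prefix $u$ deleted, etc.). For $1\leq r\leq k-1$ and $n\geq 0$, $G_{n,r}$ is defined by $s_n=D_{n-r}G_{n,r}$ (so $G_{n,r}=a_{k+1+n-r}s_n$ when $n<r$). $\widetilde{w}$ denotes the reversal of $w$. $C_j(w)$ denotes the $j$-th conjugate $x_{j+1}\cdots x_mx_1\cdots x_j$ of $w=x_1\cdots x_m$. *)

(* Defs.v *)
From mathcomp Require Import all_boot all_order all_algebra.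
From mathcomp Require Import classical_sets.

Set Implicit Arguments.
Unset Strict Implicit.
Unset Printing Implicit Defensive.

Local Open Scope classical_set_scope.

Section InfiniteWords.
Variable T : eqType.
Implicit Types (w p : seq T) (t x : nat -> T).

(* An infinite word t is a function whose value t i is its letter in
   position i.+1. *)

Definition palindrome w : Prop := rev w = w.

Definition is_prefix t w : Prop := w = mkseq t (size w).

Definition is_factor t w : Prop :=
  exists i, w = mkseq (fun j => t (i + j)) (size w).

Definition word_limit (u : nat -> seq T) t : Prop :=
  forall m, exists N, forall n, N <= n -> take m (u n) = mkseq t m.

(* p is w^(+).  It is unique: its length is at most 2 |w|, and a palindrome of
   such a length is determined by its length and its prefix w. *)
Definition pal_closure w p : Prop :=
  [/\ palindrome p, prefix w p
    & forall q, palindrome q -> prefix w q -> size p <= size q].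

(* Indices are shifted by one: u n is u_(n+1) and x n is x_(n+1).  The third
   clause makes the lengths of the u n strictly increasing, so that u lists
   the palindromic prefixes of t in order. *)
Definition standard_episturmian x t : Prop :=
  exists u : nat -> seq T,
    [/\ forall w, palindrome w /\ is_prefix t w <-> exists n, w = u n,
        u 0 = [::],
        forall n, pal_closure (rcons (u n) (x n)) (u n.+1)
      & word_limit u t].

Definition factors t (m : nat) : set (seq T) :=
  [set w | is_factor t w /\ size w = m].

End InfiniteWords.

Section FreeGroup.
Variable T : eqType.

(* Elements of the free group on T are represented by words in signed letters:
   (a, false) is a and (a, true) is a^-1. *)
Definition signed := (T * bool)%type.

Definition sinv (l : signed) : signed := (l.1, ~~ l.2).

Definition scons (l : signed) (v : seq signed) : seq signed :=
  if v is l' :: v' then if l' == sinv l then v' else l :: v else [:: l].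

Definition freduce (v : seq signed) : seq signed := foldr scons [::] v.

Definition fg_eq (v1 v2 : seq signed) : Prop := freduce v1 = freduce v2.

Definition pos (w : seq T) : seq signed := [seq (a, false) | a <- w].

End FreeGroup.

Definition wpow (T : Type) (w : seq T) (e : nat) : seq T := flatten (nseq e w).

Section EpisturmianWords.
Variables (k : nat) (hk : 1 < k) (d : nat -> nat).

(* For 1 <= i <= k this is a_i, the letters being numbered from 0 in 'I_k; for
   larger i it is the letter of the i-th block of the directive word. *)
Definition letter (i : nat) : 'I_k := Ordinal (ltn_pmod i.-1 (ltnW hk)).

(* The values d i for i >= 1 are the exponents d_i; d 0 is never used. *)
Definition directive_blocks (m : nat) : seq 'I_k :=
  flatten [seq nseq (d i) (letter i) | i <- iota 1 m].

Definition directive_word (x : nat -> 'I_k) : Prop :=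
  word_limit directive_blocks x.

(* From h = [:: s_(n-1); ...; s_0], computes s_n for n >= 1; the equations
   defining s_n are sword_small and sword_large below. *)
Definition sword_next (n : nat) (h : seq (seq 'I_k)) : seq 'I_k :=
  if n < k then
    flatten [seq wpow (nth [::] h j) (d (n - j)) | j <- iota 0 n]
      ++ [:: letter n.+1]
  else
    flatten [seq wpow (nth [::] h j) (d (n - j)) | j <- iota 0 k.-1]
      ++ nth [::] h k.-1.

Fixpoint sword_history (n : nat) : seq (seq 'I_k) :=
  if n is n'.+1 then
    let h := sword_history n' in sword_next n h :: h
  else [:: [:: letter 1]].

Definition sword (n : nat) : seq 'I_k := head [::] (sword_history n).

Lemma nth_sword_history n j : j <= n ->
  nth [::] (sword_history n) j = sword (n - j).
Proof.
elim: n j => [|n IHn] [|j] //= jn.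
by rewrite IHn.
Qed.

Lemma swordS n : sword n.+1 = sword_next n.+1 (sword_history n).
Proof. by []. Qed.

Lemma sword0 : sword 0 = [:: letter 1].
Proof. by []. Qed.

Lemma rev_iota_map (T : Type) (F : nat -> T) m l :
  [seq F i | i <- rev (iota m l)] = [seq F (m + l - j.+1) | j <- iota 0 l].
Proof.
elim: l => [|l IHl] //.
rewrite -[in LHS](addn1 l) iotaD rev_cat /= IHl -[1]addn0 iotaDl -map_comp.
by rewrite addn0 addnS subn1.
Qed.

(* s_n = s_(n-1)^d_n ... s_0^d_1 a_(n+1) for 1 <= n <= k-1 *)
Lemma sword_small n : 1 <= n < k ->
  sword n = flatten [seq wpow (sword i) (d i.+1) | i <- rev (iota 0 n)]
              ++ [:: letter n.+1].
Proof.
case: n => [//|n] /andP[_ nk].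
rewrite swordS /sword_next nk rev_iota_map; congr (flatten _ ++ _).
apply/eq_in_map => j; rewrite mem_iota add0n => /andP[_ jn].
by rewrite nth_sword_history ?subSS -?subSn.
Qed.

(* s_n = s_(n-1)^d_n ... s_(n-k+1)^d_(n-k+2) s_(n-k) for n >= k *)
Lemma sword_large n : k <= n ->
  sword n = flatten [seq wpow (sword i) (d i.+1)
                       | i <- rev (iota (n - k).+1 k.-1)]
              ++ sword (n - k).
Proof.
case: n => [|n] kn; first by move: kn; rewrite leqNgt (ltnW hk).
have kk : k.-1.+1 = k by rewrite prednK ?(ltnW hk).
rewrite swordS /sword_next ltnNge kn rev_iota_map [~~ true]/=.
rewrite nth_sword_history; last by rewrite -ltnS kk.
have nk : n.+1 - k = n - k.-1 by rewrite -[in LHS]kk subSS.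
rewrite nk; congr (flatten _ ++ _).
apply/eq_in_map => j; rewrite mem_iota add0n => /andP[_ jk].
have jn : j <= n by rewrite -ltnS (leq_trans _ kn) // (leq_trans jk) // leq_pred.
rewrite nth_sword_history //= addSn subSS subnK; last by rewrite -ltnS kk.
by rewrite subSn.
Qed.

(* D_m = s_m^(d_(m+1) - 1) s_(m-1)^d_m ... s_0^d_1 for m >= 0, and
   D_(-j) = a_(k+1-j)^-1 for 1 <= j <= k; note that Negz i is -(i + 1). *)
Definition Dword (m : int) : seq (signed 'I_k) :=
  match m with
  | Posz m => pos (wpow (sword m) (d m.+1 - 1)
      ++ flatten [seq wpow (sword i) (d i.+1) | i <- rev (iota 0 m)])
  | Negz i => [:: (letter (k - i), true)]
  end.

(* G is the word G_(n,r) defined by s_n = D_(n-r) G in the free group. *)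
Definition is_Gword (n r : nat) (G : seq 'I_k) : Prop :=
  fg_eq (pos (sword n)) (Dword (n%:Z - r%:Z)%R ++ pos G).

(* v is the word x^-1 rev(G_(n,r)) D_(n-r) G_(n,r) x^-1, where x is the last
   letter of G_(n,r).  G and v are determined by n and r, since words with the
   same image in the free group are equal. *)
Definition is_Gproduct (n r : nat) (v : seq 'I_k) : Prop :=
  exists (G : seq 'I_k) (x : 'I_k),
    [/\ is_Gword n r G, suffix [:: x] G
      & fg_eq (pos v)
          ([:: (x, true)] ++ pos (rev G) ++ Dword (n%:Z - r%:Z)%R
             ++ pos G ++ [:: (x, true)])].

Definition Omega (n r : nat) : set (seq 'I_k) :=
  if r == 0 then [set rot j (sword n) | j in `I_(size (sword n))]
  else [set w | size w = size (sword n) /\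
                exists v, is_Gproduct n r v /\ infix w v].

End EpisturmianWords.

(* Main.v *)
Require Import Defs.
From mathcomp Require Import all_boot all_order all_algebra.
From mathcomp Require Import boolp classical_sets.
From mathcomp Require Import zify.

(* Let U_i = s_(i-1)^d_i ... s_0^d_1.  The palindromic prefixes of s are the
   words s_i^j U_i, and passing from one to the next superposes two copies of
   it on the longest earlier palindromic prefix followed by the new letter, or
   puts them on both sides of a letter occurring for the first time.  Let
   N = |s_n| and let L be s_n without its last letter, a prefix of U_n.  The
   factors of length N of U_(n+1) = s_n D_n, a word of period N, are the
   conjugates of s_n.  A later step creates a new window of length N only when
   its overlap is shorter than L, which happens exactly at the first letter of
   the blocks n+2, ..., n+k; the overlap is then D_(n-r) and the new windows are
   those of the word obtained by superposing rev L and L on D_(n-r), which is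
   x^-1 rev(G_(n,r)) D_(n-r) G_(n,r) x^-1.

   Disjointness follows by counting: the listed words number, with repetitions,
   (k-1)N + 1 because the numbers |D_(n-r)| + 1, 1 <= r <= k-1, add up to N - 1,
   whereas s has at least (k-1)N + 1 factors of length N, since each of its
   prefixes can be extended to the left by all k letters. *)

Set Implicit Arguments.
Unset Strict Implicit.
Unset Printing Implicit Defensive.

(** * Finite words: periods, windows, overlapping palindromes, free reduction *)

Section Words.
Variable T : eqType.
Implicit Types (u v w y z t : seq T).

Lemma size_prefix u v : prefix u v -> size u <= size v.
Proof. by move=> /prefixP[w ->]; rewrite size_cat leq_addr. Qed.

Lemma infix_window w z :
  infix w z <-> exists2 i, i + size w <= size z & w = take (size w) (drop i z).
Proof.
split=> [/infixP[p [q ->]]|[i iz ->]].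
  exists (size p); first by rewrite !size_cat addnA leq_addr.
  by rewrite drop_size_cat // take_size_cat.
apply/infixP; exists (take i z), (drop (size w) (drop i z)).
by rewrite !cat_take_drop.
Qed.

Lemma infix_of_window i m z : infix (take m (drop i z)) z.
Proof.
apply/infixP; exists (take i z), (drop m (drop i z)).
by rewrite !cat_take_drop.
Qed.

(** The word has period [size y], so a window starting past [y] also occurs one period earlier;
    descent leads to a start inside [y]. *)
Lemma infix_periodic y t w :
  prefix t (y ++ t) -> infix w (y ++ t) -> size w = size y -> 0 < size y ->
  exists2 j, j < size y & w = rot j y.
Proof.
move=> tpre /infix_window[i iz we] wy y0; rewrite wy in iz we.
have te : t = take (size t) (y ++ t) by apply/eqP; rewrite eq_sym -prefixE.
elim/ltn_ind: i iz we => i IH iz we.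
have [iy|yi] := ltnP i (size y).
  exists i => //; rewrite we drop_cat iy take_cat size_drop ltnNge leq_subr /=.
  rewrite subKn ?(ltnW iy) // /rot; congr (_ ++ _).
  by rewrite te take_takel ?take_cat ?iy //; move: iz; rewrite size_cat; lia.
apply: (IH (i - size y)); first lia; first lia.
rewrite we drop_cat ltnNge yi /= [in LHS]te !take_drop take_takel //.
move: iz; rewrite size_cat; lia.
Qed.

Lemma rot_infix_periodic y t j :
  prefix t (y ++ t) -> (size y).-1 <= size t -> j < size y ->
  infix (rot j y) (y ++ t).
Proof.
move=> tpre yt jy; rewrite /rot.
have te : take j t = take j y.
  have {1}-> : t = take (size t) (y ++ t).
    by apply/eqP; rewrite eq_sym -prefixE.
  by rewrite take_takel ?take_cat ?jy //; lia.
apply/infixP; exists (take j y), (drop j t).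
by rewrite -{2}te -catA cat_take_drop catA cat_take_drop.
Qed.

Definition windows N z :=
  [seq take N (drop i z) | i <- iota 0 ((size z).+1 - N)].

Lemma mem_windows N z w :
  w \in windows N z <-> size w = N /\ infix w z.
Proof.
split=> [/mapP[i]|[wN /infix_window[i iz we]]].
  rewrite mem_iota => /andP[_ iz] ->; split; last exact: infix_of_window.
  by rewrite size_takel // size_drop; lia.
apply/mapP; exists i; last by rewrite -wN.
by rewrite mem_iota /= add0n; lia.
Qed.

(* A window of [u ++ t = t' ++ u] lies in one of the two copies of [u] unless
   it straddles the end of the first copy and the start of the second. *)
Lemma infix_overlap u t t' w :
  rev u = u -> u ++ t = t' ++ u -> 0 < size w -> (size w).-1 <= size u ->
  infix w (u ++ t) ->
  let L := take (size w).-1 u in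
  infix w u \/ infix w (rev L ++ take (size t + (size w).-1 - size u) t).
Proof.
move=> palu ut w0 wu /infix_window[i iz we] L.
have tt' : size t = size t'.
  by move/(congr1 size): ut; rewrite !size_cat; lia.
have [iu|ui] := leqP (i + size w) (size u).
  left; rewrite we drop_cat; case: ltnP => [iu'|]; last lia.
  rewrite take_cat size_drop; case: ltnP => ?; first exact: infix_of_window.
  have -> : size w - (size u - i) = 0 by lia.
  rewrite take0 cats0; apply/infixP; exists (take i u), [::].
  by rewrite cats0 cat_take_drop.
have [ti|it] := leqP (size t) i.
  left; rewrite we ut drop_cat ltnNge -tt' ti /=; exact: infix_of_window.
right.
have Le : rev L = drop (size u - (size w).-1) u by rewrite /L rev_take palu.
set c := _ - size u.
have sc : size (rev L ++ take c t) = (size w).-1 + c.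
  by rewrite size_cat size_rev !size_takel // /c; lia.
apply/infix_window; exists (i - (size u - (size w).-1)).
  rewrite sc /c; lia.
rewrite {1}we -{1}(cat_take_drop (size u - (size w).-1) u) -Le -catA drop_cat.
rewrite size_takel ?leq_subr // ltnNge (_ : _ <= i) /=; last lia.
rewrite -{1}(cat_take_drop c t) catA drop_cat.
rewrite ifT; last by rewrite sc /c; lia.
rewrite takel_cat // size_drop sc /c; lia.
Qed.

(** The copies of [u] at the two ends of [q] overlap in [Q], and the first copy is followed by [b].
    In [u_step] this turns a closure that is too short into an earlier palindromic prefix followed
    by the same letter. *)
Lemma palindrome_overlap u b q :
  palindrome q -> palindrome u -> prefix (rcons u b) q ->
  size q <= (size u).*2 ->
  exists Q, [/\ size Q + size q = (size u).*2, palindrome Q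
               & prefix (rcons Q b) u].
Proof.
move=> palq palu /prefixP[t' qe] qu.
have [t te] : exists t, t = b :: t' by exists (b :: t').
have qe' : q = u ++ t by rewrite te qe cat_rcons.
have tu : size t <= size u by move: qu; rewrite qe' size_cat; lia.
have e : u ++ t = rev t ++ u.
  by rewrite -[in RHS]palu -rev_cat -qe' palq.
have e1 : rev t = take (size t) u.
  by rewrite -[RHS](takel_cat t tu) e take_size_cat ?size_rev.
have u1 : u = rev t ++ drop (size t) u by rewrite e1 cat_take_drop.
have u2 : drop (size t) u ++ t = u.
  move: e; rewrite {1}u1 -catA => /eqP.
  by rewrite eqseq_cat // => /andP[_ /eqP].
exists (drop (size t) u); split.
- rewrite qe' size_cat size_drop; lia.
- have : rev (rev t ++ drop (size t) u) = drop (size t) u ++ t.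
    by rewrite -u1 u2.
  rewrite rev_cat revK => /eqP.
  by rewrite eqseq_cat ?size_rev // => /andP[/eqP].
- apply/prefixP; exists t'; by rewrite cat_rcons -te u2.
Qed.

(** The part of such a palindrome beyond [u] mirrors its beginning, which lies within [u]. *)
Lemma palindrome_eq u p q :
  palindrome p -> palindrome q -> prefix u p -> prefix u q ->
  size p = size q -> size p <= (size u).*2 -> p = q.
Proof.
move=> palp palq /prefixP[p' pe] /prefixP[q' qe] pq pu.
have sp : size p' = size q' by move: pq; rewrite pe qe !size_cat; lia.
have pu' : size p' <= size u by move: pu; rewrite pe size_cat; lia.
have tail r r' : r = u ++ r' -> palindrome r -> size r' <= size u ->
    rev r' = take (size r') u.
  move=> re palr ru; rewrite -[RHS](takel_cat r' ru) -re -palr re rev_cat.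
  by rewrite take_size_cat ?size_rev.
rewrite pe qe; congr (_ ++ _); apply: (can_inj revK).
by rewrite (tail p) // (tail q) // -sp.
Qed.

Lemma uniq_flatten_mem (I : eqType) (F : I -> seq T) (r : seq I) i j (z : T) :
  uniq (flatten [seq F l | l <- r]) -> i \in r -> j \in r ->
  z \in F i -> z \in F j -> i = j.
Proof.
elim: r => //= a r IH; rewrite cat_uniq => /and3P[_ /hasPn dis uf].
rewrite !inE => /orP[/eqP->|ir] /orP[/eqP->|jr] zi zj //; last exact: IH.
- have zf : z \in flatten [seq F l | l <- r] by apply/flatten_mapP; exists j.
  by move: (dis _ zf); rewrite /= zi.
- have zf : z \in flatten [seq F l | l <- r] by apply/flatten_mapP; exists i.
  by move: (dis _ zf); rewrite /= zj.
Qed.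

Lemma freduce_pos w : freduce (pos w) = pos w.
Proof.
by elim: w => //= a w ->; case: w => //= b w; rewrite /sinv /= xpair_eqE andbF.
Qed.

Lemma pos_inj : injective (@pos T).
Proof. by apply: inj_map => a b []. Qed.

Lemma pos_cat v w : pos (v ++ w) = pos v ++ pos w.
Proof. exact: map_cat. Qed.

Lemma foldr_scons_pos v w : foldr (@scons T) (pos w) (pos v) = pos (v ++ w).
Proof.
rewrite -(freduce_pos (v ++ w)) pos_cat /freduce foldr_cat.
by rewrite -[X in foldr _ X _ = _]freduce_pos.
Qed.

Lemma scons_inv_pos a w : scons (a, true) (pos (a :: w)) = pos w.
Proof. by rewrite /= /sinv /= eqxx. Qed.

Lemma foldr_scons_rcons v a :
  foldr (@scons T) [::] (pos (rcons v a) ++ [:: (a, true)]) = pos v.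
Proof.
rewrite -cats1 pos_cat -catA foldr_cat /= /sinv /= eqxx.
by rewrite -[X in foldr _ X]/(pos [::]) foldr_scons_pos cats0.
Qed.

End Words.

(** * The words s_n, U_i and D_m: palindromes, lengths, windows *)

Section Swords.
Variables (k : nat) (hk : 1 < k) (d : nat -> nat).
Hypothesis d_gt0 : forall i, 0 < i -> 0 < d i.

Local Notation sw := (sword hk d).
Local Notation letter := (letter hk).

Definition Uword i := flatten [seq wpow (sw j) (d j.+1) | j <- rev (iota 0 i)].

Definition Vword i j := wpow (sw i) j ++ Uword i.

(** [Dword] at a nonnegative index, as an ordinary word. *)
Definition Dpos i := Vword i (d i.+1 - 1).

Lemma Vword0 i : Vword i 0 = Uword i.
Proof. by []. Qed.

Lemma VwordS i j : Vword i j.+1 = sw i ++ Vword i j.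
Proof. by rewrite /Vword /wpow /= catA. Qed.

Lemma Uword0 : Uword 0 = [::].
Proof. by []. Qed.

Lemma UwordS i : Uword i.+1 = Vword i (d i.+1).
Proof. by rewrite /Vword /Uword -{1}[i.+1]addn1 iotaD rev_cat. Qed.

Lemma UwordSD i : Uword i.+1 = sw i ++ Dpos i.
Proof.
by rewrite UwordS /Dpos -VwordS; congr Vword; have := @d_gt0 i.+1 isT; lia.
Qed.

Lemma sword_lt i : i < k -> sw i = rcons (Uword i) (letter i.+1).
Proof.
case: i => [|i] ik; first by rewrite Uword0.
by rewrite sword_small // cats1.
Qed.

(** The last factor s_(i-k) of s_i and the appended D_(i-k) together form U_(i-k+1), the part of U_i
    below the powers listed in s_i. *)
Lemma Uword_ge i : k <= i -> Uword i = sw i ++ Dpos (i - k).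
Proof.
move=> ki; rewrite sword_large // -catA -UwordSD /Uword.
have {1}-> : i = (i - k).+1 + k.-1 by lia.
by rewrite iotaD rev_cat map_cat flatten_cat.
Qed.

Lemma letter_mod i j : (letter i.+1 == letter j.+1) = (i == j %[mod k]).
Proof. by rewrite -val_eqE. Qed.

Lemma letter_addk i : letter (i + k).+1 = letter i.+1.
Proof. by apply/eqP; rewrite letter_mod modnDr. Qed.

Lemma sword_last i : exists y, sw i = rcons y (letter i.+1).
Proof.
elim/ltn_ind: i => i IH.
have [ik|ki] := ltnP i k; first by rewrite sword_lt //; eexists.
have [|y ye] := IH (i - k); first lia.
have -> : letter i.+1 = letter (i - k).+1.
  by rewrite -(letter_addk (i - k)) subnK.
by rewrite sword_large // ye -rcons_cat; eexists.
Qed.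

Lemma sword_gt0 i : 0 < size (sw i).
Proof. by have [y ->] := sword_last i; rewrite size_rcons. Qed.

(** The word s_i U_i is U_i a U_i with a letter a if i < k, and s_i D_(i-k) rev(s_i) otherwise. From
    then on, s_i^(j+2) U_i is s_i^j U_i between s_i and rev(s_i). *)
Lemma pal_Uword_Vword i :
  palindrome (Uword i) /\ forall j, palindrome (Vword i j).
Proof.
elim/ltn_ind: i => i IH.
have palU : palindrome (Uword i).
  by case: i IH => [|i] IH //; rewrite UwordS; apply: (IH i _).2.
split=> // j.
have sU : rev (sw i ++ Uword i) = sw i ++ Uword i.
  have [ik|ki] := ltnP i k.
    by rewrite sword_lt // cat_rcons rev_cat rev_cons palU cat_rcons.
  have palD : palindrome (Dpos (i - k)) by apply: (IH _ _).2; lia.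
  rewrite rev_cat palU {1}Uword_ge // -catA -{1}palD -rev_cat -Uword_ge //.
  by rewrite palU.
elim: j {-2}j (leqnn j) => [|j IHj] [|j'] //= jj.
rewrite /palindrome VwordS; case: j' jj => [|j'] jj; first exact: sU.
have p1 : palindrome (Vword i j') by apply: IHj; lia.
have p2 : palindrome (Vword i j'.+1) by apply: IHj; lia.
rewrite rev_cat p2 {1}VwordS -catA -{1}p1 -rev_cat -(VwordS i j').
by rewrite p2.
Qed.

Lemma pal_Uword i : rev (Uword i) = Uword i.
Proof. exact: (pal_Uword_Vword i).1. Qed.

Lemma pal_Vword i j : rev (Vword i j) = Vword i j.
Proof. exact: (pal_Uword_Vword i).2. Qed.

Lemma VwordSr i j : Vword i j.+1 = Vword i j ++ rev (sw i).
Proof. by rewrite -pal_Vword VwordS rev_cat pal_Vword. Qed.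

Lemma prefix_Vword i j j' : j <= j' -> prefix (Vword i j) (Vword i j').
Proof.
move=> jj; rewrite -(subnKC jj); elim: (j' - j) => [|l IH].
  by rewrite addn0 prefix_refl.
by rewrite addnS VwordSr prefix_catl.
Qed.

Lemma prefix_Uword i i' : i <= i' -> prefix (Uword i) (Uword i').
Proof.
move=> ii; rewrite -(subnKC ii); elim: (i' - i) => [|l IH].
  by rewrite addn0 prefix_refl.
rewrite addnS UwordS; apply: prefix_trans IH _.
by rewrite -Vword0 prefix_Vword.
Qed.

Lemma prefix_Uword_Vword i i' j : i <= i' -> prefix (Uword i) (Vword i' j).
Proof.
move=> ii; apply: prefix_trans (prefix_Uword ii) _.
by rewrite -Vword0 prefix_Vword.
Qed.

Lemma size_Uword_ge i : i <= size (Uword i).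
Proof.
elim: i => [|i IH] //; rewrite UwordSD size_cat.
have : size (Uword i) <= size (Dpos i).
  by apply: size_prefix; apply: prefix_Uword_Vword.
have := sword_gt0 i; lia.
Qed.

(* |D_(i-k)| + 1, with the convention |D_(-j)| = -1. *)
Definition Dsize i := if i < k then 0 else (size (Dpos (i - k))).+1.

Lemma size_sword_Dsize i : size (sw i) + Dsize i = (size (Uword i)).+1.
Proof.
rewrite /Dsize; case: ltnP => ik; first by rewrite sword_lt // size_rcons addn0.
by rewrite (Uword_ge ik) size_cat addnS.
Qed.

(** Passing from i to i+1 drops [Dsize i] and gains |D_i| + 1. The right side changes by the same
    amount, by [size_sword_Dsize] and U_(i+1) = s_i D_i. *)
Lemma sum_Dsize i : \sum_(i <= j < i + k) Dsize j = size (Uword i).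
Proof.
elim: i => [|i IH].
  rewrite big_nat_cond big1 // => j.
  by rewrite add0n /Dsize andbT => /andP[_ ->].
have ik : i < i + k by lia.
have := size_sword_Dsize i; move: IH; rewrite big_ltn // addSn.
rewrite big_nat_recr //= (_ : Dsize (i + k) = (size (Dpos i)).+1); last first.
  by rewrite /Dsize ltnNge leq_addl addnK.
rewrite UwordSD size_cat; lia.
Qed.

(** Dropping the term j = n from [sum_Dsize] leaves |s_n| - 1. For j = n + k - r the summand is
    |D_(n-r)| + 1. *)
Lemma size_sword_sum n :
  size (sw n) = (\sum_(n.+1 <= j < n + k) Dsize j).+1.
Proof.
have nk : n < n + k by lia.
have := size_sword_Dsize n; rewrite -sum_Dsize big_ltn //; lia.
Qed.

Lemma Dsize_lt n j : n < j < n + k -> Dsize j < size (sw n).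
Proof.
move=> /andP[nj jk]; rewrite size_sword_sum ltnS.
rewrite (@big_cat_nat _ _ _ j) //=; last by apply: ltnW.
by rewrite [X in _ + X]big_ltn // addnCA leq_addr.
Qed.

Definition Lword n := take (size (sw n)).-1 (sw n).

Lemma sword_Lword n : sw n = rcons (Lword n) (letter n.+1).
Proof.
have [y ye] := sword_last n.
by rewrite /Lword ye size_rcons /= -[X in take _ X]cats1 take_size_cat.
Qed.

Lemma size_Lword n : size (Lword n) = (size (sw n)).-1.
Proof. by rewrite [in RHS]sword_Lword size_rcons. Qed.

Lemma prefix_Lword n : prefix (Lword n) (Uword n).
Proof.
have [nk|kn] := ltnP n k.
  by rewrite /Lword sword_lt // size_rcons -cats1 take_size_cat ?prefix_refl.
by rewrite (Uword_ge kn) sword_Lword -cats1 -catA prefix_prefix.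
Qed.

Lemma take_Lword n u : prefix (Uword n) u -> take (size (sw n)).-1 u = Lword n.
Proof.
move=> nu; have := prefix_trans (prefix_Lword n) nu.
by rewrite prefixE size_Lword => /eqP.
Qed.

(* This is x^-1 rev(G_(n,r)) D_(n-r) G_(n,r) x^-1 for r = n + k - i, where
   block i+1 is the first one after block n whose letter is a_(n+1-r). *)
Definition bridge n i :=
  rev (Lword n) ++
    if i < k then letter i.+1 :: Lword n
    else drop (size (Dpos (i - k))) (Lword n).

(** Hence the bridge has |s_n| - [Dsize i] windows of length |s_n|. *)
Lemma size_bridge n i : n < i < n + k ->
  (size (bridge n i)).+1 = size (sw n) + (size (sw n) - Dsize i).
Proof.
move=> nik; have := Dsize_lt nik; have := size_Lword n; have := sword_gt0 n.
rewrite /bridge size_cat size_rev /Dsize; case: (ltnP i k) => ik /=; first lia.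
rewrite size_drop; lia.
Qed.

Lemma bridge_Vword n i : n <= i ->
  bridge n i = rev (Lword n) ++
    take (size (sw i) + (size (sw n)).-1 - size (Uword i)) (rev (sw i)).
Proof.
move=> ni; rewrite /bridge; congr (_ ++ _).
have Lt := take_Lword (prefix_Uword ni).
case: ltnP => ik.
  rewrite sword_lt // size_rcons rev_rcons pal_Uword -Lt.
  by have -> : (size (Uword i)).+1 + (size (sw n)).-1 - size (Uword i)
      = (size (sw n)).-1.+1 by lia.
have -> : rev (sw i) = drop (size (Dpos (i - k))) (Uword i).
  by rewrite -pal_Uword (Uword_ge ik) rev_cat pal_Vword drop_size_cat.
rewrite {1}(Uword_ge ik) size_cat -Lt.
have [c|c] := leqP (size (Dpos (i - k))) (size (sw n)).-1.
  by rewrite take_drop; congr (drop _ (take _ _)); lia.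
(* When D_(i-k) is longer than L, both sides are empty by truncated subtraction. *)
rewrite drop_oversize ?(size_take_min) ?geq_min ?(ltnW c) //.
rewrite (_ : _ - _ = 0) ?take0 //; lia.
Qed.

(** The palindrome U_i begins with L, so it ends with rev(L), and in U_i rev(s_i) this end is
    followed by the rest of the bridge. *)
Lemma bridge_infix n i : n <= i -> infix (bridge n i) (Uword i.+1).
Proof.
move=> ni; rewrite bridge_Vword // UwordS.
apply: (@infix_prefix_trans _ (Vword i 1)); last first.
  by apply: prefix_Vword; apply: d_gt0.
set c := _ - size (Uword i).
rewrite VwordSr Vword0 -[in X in infix _ X](cat_take_drop c (rev (sw i))).
rewrite catA infix_catr //.
have /prefixP[y ye] := prefix_trans (prefix_Lword n) (prefix_Uword ni).
by rewrite -[Uword i]pal_Uword ye rev_cat -catA suffix_infix.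
Qed.

Lemma infix_UwordS n i w : n < i -> size w = size (sw n) ->
  infix w (Uword i.+1) ->
  infix w (Uword i) \/ (i < n + k) /\ infix w (bridge n i).
Proof.
move=> ni sw_w; have w0 : 0 < size w by rewrite sw_w sword_gt0.
have LU : (size (sw n)).-1 <= size (Uword n).
  by rewrite -size_Lword size_prefix ?prefix_Lword.
rewrite UwordS; elim: (d i.+1) => [|j IH]; first by left.
rewrite VwordSr => wV.
have pU := prefix_Uword_Vword j (ltnW ni).
have /= := infix_overlap (pal_Vword i j) _ w0 _ wV => /(_ (sw i)).
rewrite sw_w take_Lword // => -[||/IH //|].
- by rewrite -VwordSr VwordS.
- by apply: leq_trans LU (size_prefix pU).
(* Only the first copy of s_i added to U_i can create a bridge. *)
case: j {IH wV} pU => [|j] pU.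
  rewrite Vword0 size_rev -bridge_Vword; last exact: ltnW.
  have [ik|ki] := ltnP i (n + k); first by right.
  (* For i >= n + k, D_(i-k) is at least as long as L, so the bridge is just rev(L), too short to
     contain [w]. *)
  rewrite /bridge ifN ?drop_oversize ?cats0; last first.
  - by rewrite -leqNgt; apply: leq_trans ki; apply: leq_addl.
  - rewrite size_Lword; apply: leq_trans LU _.
    by apply/size_prefix/prefix_Uword_Vword; lia.
  move=> /infix_window[l]; rewrite size_rev size_Lword sw_w.
  by have := sword_gt0 n; lia.
(* For later copies of s_i the overlap is [Vword i j], no shorter than L: again only rev(L)
   remains. *)
rewrite size_rev VwordS size_cat.
have := size_prefix (prefix_Uword_Vword j (ltnW ni)) => s1.
rewrite (_ : _ - _ = 0) ?take0 ?cats0; last first.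
  by apply/eqP; rewrite subn_eq0 leq_add2l; apply: leq_trans LU s1.
move=> /infix_window[l]; rewrite size_rev size_Lword sw_w.
by have := sword_gt0 n; lia.
Qed.

Lemma infix_UwordSn n w : size w = size (sw n) ->
  infix w (Uword n.+1) <-> exists2 j, j < size (sw n) & w = rot j (sw n).
Proof.
move=> sw_w; rewrite UwordSD.
have pD : prefix (Dpos n) (sw n ++ Dpos n).
  by rewrite -UwordSD UwordS prefix_Vword // leq_subr.
split=> [wU|[j jn ->]]; first exact: infix_periodic wU sw_w (sword_gt0 n).
apply: rot_infix_periodic => //; rewrite -size_Lword.
apply/size_prefix/(prefix_trans (prefix_Lword n)); exact: prefix_Uword_Vword.
Qed.

Lemma infix_Uword n i w : size w = size (sw n) ->
  infix w (Uword i) ->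
  (exists2 j, j < size (sw n) & w = rot j (sw n)) \/
  (exists2 j, n < j < n + k & infix w (bridge n j)).
Proof.
move=> sw_w.
elim: i => [|i IH].
  by rewrite Uword0 infixs0 => /eqP w0; have := sword_gt0 n; rewrite -sw_w w0.
have [ni|i_n] := ltnP n i.
  move=> /(infix_UwordS ni sw_w)[/IH //|[ik wb]].
  by right; exists i => //; rewrite ni.
move=> wU; left; apply/(infix_UwordSn sw_w).
by apply: infix_prefix_trans wU _; apply: prefix_Uword.
Qed.

End Swords.

(* [size] at the [eqType] sort and at ['I_k] are different atoms for [lia]. *)
Local Ltac slia := simpl in *; lia.

(** * Reduction of the free-group products to bridges *)

Section Gproducts.
Variables (k : nat) (hk : 1 < k) (d : nat -> nat).
Hypothesis d_gt0 : forall i, 0 < i -> 0 < d i.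
Local Notation sw := (sword hk d).

Lemma Dword_ge n r : r <= n ->
  Dword hk d (n%:Z - r%:Z)%R = pos (Dpos hk d (n - r)).
Proof. by move=> rn; rewrite subzn. Qed.

Lemma Dword_lt n r : n < r -> r < k ->
  Dword hk d (n%:Z - r%:Z)%R = [:: (letter hk (n + k - r).+1, true)].
Proof.
move=> nr rk; have -> : (n%:Z - r%:Z)%R = Negz (r - n).-1 by lia.
by rewrite /Dword; congr [:: (letter _ _, _)]; lia.
Qed.

Lemma is_Gword_ge n r G : r <= n ->
  is_Gword hk d n r G <-> sw n = Dpos hk d (n - r) ++ G.
Proof.
move=> rn; rewrite /is_Gword /fg_eq Dword_ge // -pos_cat !freduce_pos.
by split=> [/pos_inj|->].
Qed.

Lemma is_Gword_lt n r G : n < r -> r < k ->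
  is_Gword hk d n r G <-> G = letter hk (n + k - r).+1 :: sw n.
Proof.
move=> nr rk; rewrite /is_Gword /fg_eq Dword_lt //.
rewrite [freduce (_ ++ _)]/= -/(freduce _) !freduce_pos.
split=> [|->]; last by rewrite scons_inv_pos.
(* Unless the first letter of [G] cancels, the reduced word starts with an inverse letter and cannot
   be the nonempty positive word s_n. *)
have [y ->] := sword_last hk d n; case: G => [|c G] /=.
  by case: y.
case: eqP => [[->] /pos_inj -> //|_].
by case: y.
Qed.

(** If n < r, then G = a s_n and the product reduces to rev(L) a L. If r <= n, write L = D G' and G
    = G' x; since D is a palindrome, the product rev(G') D G' is rev(L) G'. *)
Lemma is_GproductE n r v : 0 < r < k ->
  is_Gproduct hk d n r v <-> v = bridge hk d n (n + k - r).
Proof.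
move=> /andP[r0 rk].
have Lk := sword_Lword hk d n.
have [nr|rn] := ltnP n r.
  have bE : bridge hk d n (n + k - r) =
      rev (Lword hk d n) ++ letter hk (n + k - r).+1 :: Lword hk d n.
    by rewrite /bridge ifT //; lia.
  set a := letter hk (n + k - r).+1 in bE *.
  have prodE : freduce ([:: (letter hk n.+1, true)] ++ pos (rev (a :: sw n)) ++
      Dword hk d (n%:Z - r%:Z)%R ++ pos (a :: sw n) ++
      [:: (letter hk n.+1, true)]) = pos (bridge hk d n (n + k - r)).
    rewrite Dword_lt // -/a /freduce 3!foldr_cat Lk.
    rewrite -rcons_cons foldr_scons_rcons.
    rewrite [foldr _ _ [:: (a, true)]]/= /sinv /= eqxx foldr_scons_pos.
    rewrite rev_cons rev_rcons /= eqxx.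
    by rewrite -/(pos _) cat_rcons bE.
  split=> [[G [c [/(is_Gword_lt _ nr rk) -> /suffixP[y ye]]]]|->].
    have -> : c = letter hk n.+1.
      by move: ye; rewrite Lk -rcons_cons cats1 => /rcons_inj[].
    by rewrite /fg_eq prodE freduce_pos => /pos_inj.
  exists (a :: sw n), (letter hk n.+1); split.
  - exact/is_Gword_lt.
  - by rewrite Lk -rcons_cons -cats1 suffix_suffix.
  - by rewrite /fg_eq prodE freduce_pos.
set D := Dpos hk d (n - r).
have nik : n < n + k - r < n + k by lia.
have bE : bridge hk d n (n + k - r) =
    rev (Lword hk d n) ++ drop (size D) (Lword hk d n).
  rewrite /bridge ifN; last lia.
  by rewrite (_ : n + k - r - k = n - r) //; lia.
have Dn : size D < size (Lword hk d n).
  have := Dsize_lt hk d_gt0 nik; rewrite /Dsize ifN; last lia.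
  rewrite size_Lword (_ : n + k - r - k = n - r); last lia.
  rewrite -/D; lia.
(* Both words are prefixes of U_(n+1), and D is the shorter one. *)
have DL : prefix D (Lword hk d n).
  have pL := prefix_trans (prefix_Lword hk d_gt0 n)
    (prefix_Uword hk d_gt0 (leqnSn n)).
  have pD : prefix D (Uword hk d n.+1).
    apply: (@prefix_trans _ (Uword hk d (n - r).+1)).
      by rewrite UwordS; apply: prefix_Vword => //; apply: leq_subr.
    by apply: prefix_Uword => //; lia.
  move: pL pD; rewrite !prefixE => /eqP pL /eqP pD.
  by rewrite -pL take_takel ?pD // ltnW.
have [G' G'e] := prefixP DL.
have palD : rev D = D by apply: pal_Vword.
have prodE : freduce ([:: (letter hk n.+1, true)] ++
    pos (rev (rcons G' (letter hk n.+1))) ++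
    Dword hk d (n%:Z - r%:Z)%R ++ pos (rcons G' (letter hk n.+1)) ++
    [:: (letter hk n.+1, true)]) = pos (bridge hk d n (n + k - r)).
  rewrite Dword_ge // -/D /freduce 3!foldr_cat foldr_scons_rcons.
  rewrite !foldr_scons_pos rev_rcons /= eqxx -/(pos _).
  by rewrite bE G'e rev_cat palD drop_size_cat // catA.
have GE G : is_Gword hk d n r G <-> G = rcons G' (letter hk n.+1).
  rewrite is_Gword_ge // Lk G'e -/D rcons_cat.
  split=> [/eqP|->] //; by rewrite eqseq_cat // => /andP[_ /eqP].
split=> [[G [c [/GE -> /suffixP[y ye]]]]|->].
  have -> : c = letter hk n.+1.
    by move: ye; rewrite cats1 => /rcons_inj[].
  by rewrite /fg_eq prodE freduce_pos => /pos_inj.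
exists (rcons G' (letter hk n.+1)), (letter hk n.+1); split.
- exact/GE.
- by rewrite -cats1 suffix_suffix.
- by rewrite /fg_eq prodE freduce_pos.
Qed.

End Gproducts.

(** * The infinite word and the blocks of its directive word *)

Section Episturmian.
Variables (k : nat) (hk : 1 < k) (d : nat -> nat).
Hypothesis d_gt0 : forall i, 0 < i -> 0 < d i.
Variables (x s : nat -> 'I_k).
Hypothesis hx : directive_word hk d x.
Local Notation sw := (sword hk d).
Local Notation U := (Uword hk d).
Local Notation V := (Vword hk d).

(** The position, counted from 0, of the first letter of block i+1; the palindromic prefix with this
    index is U_i. *)
Definition block_start i := size (directive_blocks hk d i).

Lemma directive_blocksS i :
  directive_blocks hk d i.+1 =
  directive_blocks hk d i ++ nseq (d i.+1) (letter hk i.+1).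
Proof.
rewrite /directive_blocks -{1}[i.+1]addn1 iotaD map_cat flatten_cat /= cats0.
by rewrite add1n.
Qed.

Lemma block_startS i : block_start i.+1 = block_start i + d i.+1.
Proof. by rewrite /block_start directive_blocksS size_cat size_nseq. Qed.

Lemma block_start_ge i : i <= block_start i.
Proof.
elim: i => // i IH; rewrite block_startS; have := @d_gt0 i.+1 isT; lia.
Qed.

Lemma block_start_le i j : i <= j -> block_start i <= block_start j.
Proof.
move=> ij; rewrite -(subnKC ij); elim: (j - i) => [|l IH]; rewrite ?addn0 //.
by rewrite addnS block_startS; apply: leq_trans IH (leq_addr _ _).
Qed.

Lemma prefix_directive_blocks i j : i <= j ->
  prefix (directive_blocks hk d i) (directive_blocks hk d j).
Proof.
move=> ij; rewrite -(subnKC ij); elim: (j - i) => [|l IH].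
  by rewrite addn0 prefix_refl.
by rewrite addnS directive_blocksS prefix_catl.
Qed.

Lemma directive_letter i j :
  j < d i.+1 -> x (block_start i + j) = letter hk i.+1.
Proof.
move=> jd; have [N /(_ (maxn N i.+1) (leq_maxl _ _))] := hx (block_start i.+1).
have := prefix_directive_blocks (leq_maxr N i.+1).
rewrite prefixE -/(block_start _) => /eqP ->.
move=> /(congr1 (fun w => nth (x 0) w (block_start i + j))).
rewrite nth_mkseq ?block_startS ?ltn_add2l // => <-.
by rewrite directive_blocksS nth_cat ltnNge leq_addr /= addKn nth_nseq jd.
Qed.

Lemma block_index m : exists i j, j < d i.+1 /\ m = block_start i + j.
Proof.
elim: m => [|m [i [j [jd ->]]]].
  by exists 0, 0; split => //; apply: d_gt0.
have [jd'|] := ltnP j.+1 (d i.+1); first by exists i, j.+1; rewrite addnS.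
move=> dj; exists i.+1, 0; split; first exact: d_gt0.
by rewrite block_startS addn0; lia.
Qed.

(** * The palindromic prefixes of s *)

Section PalindromicPrefixes.
Variable u : nat -> seq 'I_k.
Hypothesis u_pal :
  forall w, palindrome w /\ is_prefix s w <-> exists n, w = u n.
Hypothesis u0 : u 0 = [::].
Hypothesis uS : forall n, pal_closure (rcons (u n) (x n)) (u n.+1).

Lemma prefix_rcons_u m : prefix (rcons (u m) (x m)) (u m.+1).
Proof. by have [] := uS m. Qed.

Lemma prefix_u l m : l <= m -> prefix (u l) (u m).
Proof.
move=> lm; rewrite -(subnKC lm); elim: (m - l) => [|e IH].
  by rewrite addn0 prefix_refl.
rewrite addnS; apply: prefix_trans IH _.
by apply: prefix_trans (prefix_rcons_u _); apply: prefix_rcons.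
Qed.

Lemma prefix_of_is_prefix (w v : seq 'I_k) :
  is_prefix s v -> prefix w v -> is_prefix s w.
Proof.
rewrite /is_prefix => ve /prefixP[t vt].
have : take (size w) v = w by rewrite vt take_size_cat.
move=> wv; rewrite -[LHS]wv ve /mkseq -map_take take_iota.
congr (map _ (iota _ _)).
by apply/minn_idPl; rewrite vt size_cat leq_addr.
Qed.

(** A closure shorter than s_i^(j+1) U_i would make the two copies of u_m overlap in more than |u_m|
    - |s_i| letters. But the overlap is an earlier u_l with x_l = x_m: in the same block it is at
    most |u_m| - |s_i| long, and in an earlier block at most |D_(i-k)| = |U_i| - |s_i|. *)
Lemma u_step i j :
  j < d i.+1 ->
  (forall i' j', j' <= d i'.+1 -> block_start i' + j' <= block_start i + j ->
     u (block_start i' + j') = V i' j') ->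
  u (block_start i + j).+1 = V i j.+1.
Proof.
move=> jd IH; set m := block_start i + j.
have um : u m = V i j by apply: IH => //; apply: ltnW.
have [palq pq minq] := uS m.
have pp : prefix (rcons (u m) (x m)) (V i j.+1).
  have [y ye] := sword_last hk d i.
  rewrite directive_letter // um (VwordSr hk d_gt0) ye rev_rcons -cat_rcons.
  exact: prefix_prefix.
have palp : palindrome (V i j.+1) by apply: pal_Vword.
have ple := minq _ palp pp.
have sp : size (V i j.+1) = size (sw i) + size (V i j).
  by rewrite VwordS size_cat.
have sD := size_sword_Dsize hk d_gt0 i.
have UV : size (U i) <= size (V i j) by rewrite /Vword size_cat leq_addl.
suff qge : size (V i j.+1) <= size (u m.+1).
  apply: (palindrome_eq palq palp pq pp).
    by apply/eqP; rewrite eqn_leq ple.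
  by rewrite size_rcons um; slia.
rewrite leqNgt; apply/negP => qlt.
have palu : palindrome (u m) by rewrite um; apply: pal_Vword.
have [|Q [sQ palQ pQ]] := palindrome_overlap palq palu pq.
  by rewrite um; slia.
have [l Ql] : exists l, Q = u l.
  apply/u_pal; split=> //; apply: (@prefix_of_is_prefix _ (u m)).
    by have [] := (u_pal (u m)).2 (ex_intro _ m erefl).
  by apply: prefix_trans pQ; apply: prefix_rcons.
have lm : l < m.
  rewrite ltnNge; apply/negP => /prefix_u /size_prefix.
  have := size_prefix pQ; rewrite size_rcons -Ql; slia.
(* Both letters follow [u l] inside [u m]. *)
have xl : x l = x m.
  have := prefix_trans (prefix_rcons_u l) (prefix_u lm).
  move: pQ; rewrite !prefixE -Ql !size_rcons => /eqP -> /eqP.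
  by move=> /rcons_inj[].
have [i' [j' [jd' le]]] := block_index l.
have ul : u l = V i' j'.
  by rewrite le; apply: IH; [apply: ltnW|rewrite -le ltnW].
have mod_i : (i' == i %[mod k]).
  by rewrite -(letter_mod hk); move: xl; rewrite le !directive_letter // => ->.
have ii : i' <= i.
  rewrite leqNgt; apply/negP => /block_start_le; rewrite block_startS; slia.
move: sQ qlt; rewrite Ql ul um sp => sQ qlt.
move: ii; rewrite leq_eqVlt => /orP[/eqP ei|ii].
  have jj : j' < j by move: lm; rewrite le ei; slia.
  have := size_prefix (prefix_Vword hk d_gt0 i (_ : j' <= j.-1)).
  have : size (V i j) = size (sw i) + size (V i j.-1).
    by rewrite -size_cat -VwordS; congr (size (V _ _)); slia.
  move: sQ; rewrite ei; slia.
(* Equal letters give block indices congruent modulo k. *)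
have ik : i' + k <= i.
  move: mod_i; rewrite eq_sym eqn_mod_dvd ?(ltnW ii) // => /dvdn_leq; slia.
have sVD : size (V i' j') <= size (Dpos hk d (i - k)).
  apply: size_prefix.
  have [e|lt] := eqVneq (i - k) i'.
    by rewrite e; apply: prefix_Vword => //; slia.
  apply: (@prefix_trans _ (U i'.+1)).
    by rewrite UwordS; apply: prefix_Vword => //; slia.
  by apply: prefix_Uword_Vword => //; slia.
move: sD; rewrite /Dsize ifN; last by rewrite -leqNgt; slia.
move: sVD sQ qlt UV ple.
slia.
Qed.

Lemma u_block i j : j <= d i.+1 -> u (block_start i + j) = V i j.
Proof.
move: {2}(_ + _) (leqnn (block_start i + j)) => m.
elim: m i j => [|m IH] i j.
  rewrite leqn0 addn_eq0 => /andP[/eqP i0 /eqP -> _].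
  have /eqP := leqnn (block_start i); have := block_start_ge i.
  by rewrite i0 leqn0 => /eqP -> _; rewrite u0.
have step i' j' : j' < d i'.+1 -> block_start i' + j' <= m ->
    u (block_start i' + j').+1 = V i' j'.+1.
  move=> jd jm; apply: u_step => // i'' j'' jd'' le.
  by apply: IH => //; apply: leq_trans le jm.
case: j => [|j]; last by rewrite addnS => jm jd; apply: step.
case: i => [|i]; first by move=> _ _; rewrite u0.
(* The start of a block is also the end of the preceding one, so the step is taken in the preceding
   block. *)
rewrite addn0 block_startS Vword0 UwordS.
have := @d_gt0 i.+1 isT; case: (d i.+1) (step i) => // e st _ jm _.
by rewrite addnS; apply: st => //; rewrite -ltnS -addnS.
Qed.

End PalindromicPrefixes.

(** * Factors of s and a lower bound for their number *)

Hypothesis hs : standard_episturmian x s.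

Lemma is_prefix_Uword i : is_prefix s (U i).
Proof.
have [u [u_pal u0 uS _]] := hs.
have := u_block u_pal u0 uS (leq0n (d i.+1)); rewrite addn0 Vword0 => <-.
by have [] := (u_pal (u (block_start i))).2 (ex_intro _ _ erefl).
Qed.

Lemma is_factor_Uword w : is_factor s w <-> exists i, infix w (U i).
Proof.
split=> [[p we]|[i /infix_window[p pU we]]].
  (* U_i has at least i letters, so this one contains the whole occurrence. *)
  exists (p + size w); apply/infix_window; exists p.
    exact: (size_Uword_ge hk d_gt0).
  apply: (@eq_from_nth _ (s 0)) => [|j jw].
    rewrite size_takel // size_drop leq_subRL ?(size_Uword_ge hk d_gt0) //.
    by apply: leq_trans (size_Uword_ge hk d_gt0 _); apply: leq_addr.
  rewrite nth_take // nth_drop is_prefix_Uword nth_mkseq; last first.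
    by apply: leq_trans (size_Uword_ge hk d_gt0 _); rewrite ltn_add2l.
  by rewrite {1}we nth_mkseq.
exists p; apply: (@eq_from_nth _ (s 0)) => [|j jw]; rewrite ?size_mkseq //.
rewrite nth_mkseq // {1}we nth_take // nth_drop is_prefix_Uword nth_mkseq //.
by apply: leq_trans pU; rewrite ltn_add2l.
Qed.

(** In s_i U_i the prefix U_i of s is preceded by the last letter of s_i. It suffices to take i
    congruent to [b] modulo k and at least m. *)
Lemma prefix_left_special (b : 'I_k) m : is_factor s (b :: mkseq s m).
Proof.
apply/is_factor_Uword; exists (b + m * k).+1.
set i := b + m * k.
have bE : letter hk i.+1 = b.
  by apply/val_inj; rewrite /= /i addnC modnMDl modn_small.
have [y ye] := sword_last hk d i.
have mi : m <= size (U i).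
  apply: leq_trans (size_Uword_ge hk d_gt0 _); rewrite /i.
  by apply: leq_trans (leq_addl _ _); apply: leq_pmulr; apply: ltnW.
have pU : prefix (mkseq s m) (U i).
  rewrite is_prefix_Uword prefixE size_mkseq /mkseq -map_take take_iota.
  by rewrite (minn_idPl mi).
rewrite UwordS.
apply: infix_prefix_trans (prefix_Vword hk d_gt0 i (d_gt0 (ltn0Sn i))).
rewrite VwordS Vword0 ye bE cat_rcons; apply: infix_catl.
by apply: prefixW; rewrite prefix_cons eqxx.
Qed.

(** Such a factor occurs at a positive position, hence after some letter. *)
Lemma left_extension w m : is_factor s w -> size w = m -> w != mkseq s m ->
  exists b, is_factor s (b :: w).
Proof.
move=> [[|i] we] wm wp.
  by move: wp; rewrite -wm {1}we eqxx.
exists (s i), i; apply: (@eq_from_nth _ (s 0)) => [|[|j] jw].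
- by rewrite size_mkseq.
- by rewrite nth_mkseq // addn0.
- by rewrite nth_mkseq //= {1}we nth_mkseq // addSnnS.
Qed.

Lemma factor_list m : exists F : seq (seq 'I_k),
  uniq F /\ forall w, w \in F <-> is_factor s w /\ size w = m.
Proof.
exists [seq val t | t <- enum {: m.-tuple 'I_k} & `[<is_factor s (val t)>]].
split.
  rewrite map_inj_uniq; last exact: val_inj.
  exact/filter_uniq/enum_uniq.
move=> w; split=> [/mapP[t]|[ws wm]].
  by rewrite mem_filter => /andP[/asboolP ? _] ->; rewrite size_tuple.
have wt : size w == m by apply/eqP.
apply/mapP; exists (Tuple wt) => //.
by rewrite mem_filter mem_enum andbT; apply/asboolP.
Qed.

(** From length m to m+1, the prefix of s has k left extensions and every other factor at least one,
    so the number of factors grows by at least k - 1. *)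
Lemma complexity_ge m (F : seq (seq 'I_k)) :
  (forall w, w \in F <-> is_factor s w /\ size w = m) -> uniq F ->
  (m * k.-1).+1 <= size F.
Proof.
elim: m F => [|m IH] F FE uF.
  rewrite mul0n; have : [::] \in F by apply/FE; split => //; exists 0.
  by case: F {FE uF}.
have [F' [uF' F'E]] := factor_list m.
have {}IH := IH _ F'E uF'.
set p := mkseq s m.
have pF : p \in F'.
  by apply/F'E; split; [exists 0|]; rewrite size_mkseq.
(* One left extension is chosen for each factor; the default [w] does not arise for factors other
   than [p]. *)
pose ext (w : seq 'I_k) :=
  if [pick b | `[<is_factor s (b :: w)>]] is Some b then b :: w else w.
have extE w : w \in rem p F' -> is_factor s (ext w) /\ exists b, ext w = b :: w.
  rewrite rem_filter // mem_filter => /andP[/= wp /F'E[ws wm]].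
  have [b wb] := left_extension ws wm wp.
  rewrite /ext; case: pickP => [c /asboolP wc|/(_ b)].
    by split => //; exists c.
  by move=> /asboolP.
pose A := [seq b :: p | b <- enum 'I_k].
pose B := [seq ext w | w <- rem p F'].
have uAB : uniq (A ++ B).
  rewrite cat_uniq; apply/and3P; split.
  - by rewrite map_inj_uniq ?enum_uniq // => a b [].
  - apply/hasPn => z /mapP[w wF ->]; apply/negP => /mapP[b _].
    have [_ [c ->]] := extE _ wF; move=> [_ wp].
    by move: wF; rewrite wp mem_rem_uniqF.
  - rewrite map_inj_in_uniq ?rem_uniq // => w w' wF w'F.
    by have [_ [c ->]] := extE _ wF; have [_ [c' ->]] := extE _ w'F; move=> [].
have sAB : {subset A ++ B <= F}.
  move=> z; rewrite mem_cat => /orP[/mapP[b _ ->]|/mapP[w wF ->]]; apply/FE.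
    by split; [apply: prefix_left_special|rewrite /= size_mkseq].
  have [wf [b we]] := extE _ wF; split => //.
  have /F'E[_ wm] := mem_rem wF.
  by rewrite we /= wm.
have sA : size A = k by rewrite /A size_map size_enum_ord.
have sB : size B = (size F').-1 by rewrite /B size_map size_rem.
have := uniq_leq_size uAB sAB; rewrite size_cat sA sB.
move: IH; rewrite mulSn; slia.
Qed.

End Episturmian.

(** * Counting the listed words *)

Section Decomposition.
Variables (k : nat) (hk : 1 < k) (d : nat -> nat).
Hypothesis d_gt0 : forall i, 0 < i -> 0 < d i.
Variable n : nat.
Local Notation N := (size (sword hk d n)).
Local Open Scope classical_set_scope.

(** Lists [Omega] position by position, so that its length is explicit; repetitions are excluded
    only at the end. *)
Definition Omega_list r : seq (seq 'I_k) :=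
  if r == 0 then [seq rot j (sword hk d n) | j <- iota 0 N]
  else windows N (bridge hk d n (n + k - r)).

Lemma mem_Omega_list r w : r < k -> w \in Omega_list r <-> Omega hk d n r w.
Proof.
move=> rk; rewrite /Omega_list /Omega; case: eqP => [_|/eqP].
  split=> [/mapP[j]|[j /= jN <-]].
    by rewrite mem_iota => /andP[_ jN] ->; exists j.
  by apply/mapP; exists j => //; rewrite mem_iota.
rewrite -lt0n => r0.
have r0k : 0 < r < k by rewrite r0.
split=> [/mem_windows[wN wb]|[wN [v [/(is_GproductE hk d_gt0 _ _ r0k) -> wb]]]].
  split=> //; exists (bridge hk d n (n + k - r)); split=> //.
  exact/is_GproductE.
exact/mem_windows.
Qed.

(** There are N conjugates and N - [Dsize] windows for each r; the subtracted terms add up to N -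
    1. *)
Lemma size_Omega_lists :
  size (flatten [seq Omega_list r | r <- iota 0 k]) = (N * k.-1).+1.
Proof.
rewrite size_flatten /shape -map_comp sumnE big_map.
have -> : iota 0 k = index_iota 0 k by rewrite /index_iota subn0.
rewrite big_ltn ?(ltnW hk) //=.
rewrite {1}/Omega_list eqxx size_map size_iota.
have -> : \sum_(1 <= r < k) size (Omega_list r) =
    \sum_(1 <= r < k) (N - Dsize hk d (n + k - r)).
  apply: eq_big_nat => r /andP[r0 rk].
  rewrite /Omega_list (gtn_eqF r0) size_map size_iota.
  rewrite size_bridge ?addKn //; lia.
have sD : \sum_(1 <= r < k) Dsize hk d (n + k - r) = N.-1.
  rewrite [in RHS](size_sword_sum hk d_gt0) /= -[n.+1]add1n big_addn.
  rewrite addKn big_nat_rev; apply: eq_big_nat => r rk.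
  by congr Dsize; lia.
have sN : \sum_(1 <= r < k) (N - Dsize hk d (n + k - r)) + N.-1 = N * k.-1.
  rewrite -sD -big_split /= -subn1 mulnC -sum_nat_const_nat.
  apply: eq_big_nat => r rk; rewrite subnK // ltnW //.
  by apply: Dsize_lt => //; lia.
have := sword_gt0 hk d n; lia.
Qed.

End Decomposition.

Local Open Scope classical_set_scope.

Theorem theorem4p19 (k : nat) (hk : 1 < k) (d : nat -> nat)
    (d_gt0 : forall i, 0 < i -> 0 < d i) (x s : nat -> 'I_k)
    (hx : directive_word hk d x) (hs : standard_episturmian x s)
    (n : nat) (n_ge1 : 1 <= n) :
  factors s (size (sword hk d n)) = \bigcup_(r in `I_k) Omega hk d n r /\
  trivIset `I_k (Omega hk d n).
Proof.
have cover w : factors s (size (sword hk d n)) w <->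
    exists2 r, r < k & Omega hk d n r w.
  split=> [[/(is_factor_Uword d_gt0 hx hs)[i wU] wN]|[r rk]].
    have [[j jN ->]|[j nj wb]] := infix_Uword d_gt0 wN wU.
      by exists 0; [apply: ltnW | exists j].
    exists (n + k - j); first lia.
    apply/(mem_Omega_list hk d_gt0); first lia.
    rewrite /Omega_list ifN; last lia.
    by apply/mem_windows; rewrite subKn //; lia.
  move=> /(mem_Omega_list hk d_gt0 _ _ rk); rewrite /Omega_list.
  case: eqP => [_ /mapP[j]|r0 /mem_windows[wN wb]].
    rewrite mem_iota => /andP[_ jN] ->; split; last by rewrite size_rot.
    apply/(is_factor_Uword d_gt0 hx hs); exists n.+1.
    by apply/(infix_UwordSn d_gt0); [rewrite size_rot | exists j].
  split=> //; apply/(is_factor_Uword d_gt0 hx hs); exists (n + k - r).+1.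
  by apply: infix_trans wb _; apply: bridge_infix => //; lia.
split.
  apply/seteqP; split=> w; first by move=> /cover[r]; exists r.
  by move=> [r ? ?]; apply/cover; exists r.
have [F [uF FE]] := factor_list s (size (sword hk d n)).
(* The listed words include all factors and are no more numerous than the lower bound on these, so
   none is listed twice. *)
have uO : uniq (flatten [seq Omega_list hk d n r | r <- iota 0 k]).
  apply: (leq_size_uniq uF).
    move=> w /FE /cover[r rk rw].
    apply/flatten_mapP; exists r; first by rewrite mem_iota.
    exact/(mem_Omega_list hk d_gt0).
  by rewrite size_Omega_lists //; apply: (complexity_ge d_gt0 hx hs FE uF).
move=> i j /= ik jk [w [wi wj]].
apply: (uniq_flatten_mem uO); rewrite ?mem_iota //;
  apply/(mem_Omega_list hk d_gt0) => //; [exact: wi | exact: wj].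
Qed.
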